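(* Let $d\ge 1$ be an integer and let $\{a_k\}_{k=0}^\infty$ be a sequence of complex numbers. Then $\{a_k\}_{k=0}^\infty$ is a solution of some recurrence relation of length $d$ in the class $\mathcal{S}$ if and only if there exist real constants $R>0$ and $C>0$ such that for each $m\ge 0$ the shifted sequence $\{a_{m+k}\}_{k=0}^\infty$ possesses $(d-1,R,C)$-Taylor domination.
   Context: The class $\mathcal{S}$ consists of the linear non-stationary homogeneous recurrence relations of a fixed length $d$ with uniformly bounded coefficients, i.e. relations of the form $$a_k=\sum_{j=1}^d c_j(k)\, a_{k-j},\qquad k=d,d+1,\dots,$$ where the complex coefficients $c_j(k)$ satisfy $\sup_{k\ge d,\ 1\le j\le d}|c_j(k)|<\infty$. The initial terms $a_0,\dots,a_{d-1}$ are arbitrary. For an integer $N\ge 0$ and reals $R>0$, $C>0$, a sequence $\{b_k\}_{k=0}^\infty$ of complex numbers (equivalently, the power series $\sum_{k\ge0} b_kz^k$, where $R$ is at most its radius of convergence) possesses $(N,R,C)$-Taylor domination if for each $k\ge N+1$ $$|b_k|R^k\le C\max_{i=0,\dots,N}|b_i|R^i .$$ (This inequality for all $k\ge N+1$ already forces $R$ to be at most the radius of convergence of $\sum_{k\ge 0} b_kz^k$.) *)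

(* Defs.v *)
From Stdlib Require Import Reals RList List.
From Coquelicot Require Import Coquelicot.
Open Scope R_scope.

(* [c j k] is the coefficient c_j(k); its values for j outside 1..d or k < d
   are irrelevant to both predicates below. *)
Definition bounded_coefficients (d : nat) (c : nat -> nat -> C) : Prop :=
  exists K : R, forall k j : nat,
    (d <= k)%nat -> (1 <= j <= d)%nat -> Cmod (c j k) <= K.

Definition solves_recurrence (d : nat) (c : nat -> nat -> C) (a : nat -> C) : Prop :=
  forall k : nat, (d <= k)%nat ->
    a k = sum_n_m (fun j => Cmult (c j k) (a (k - j)%nat)) 1 d.

Definition taylor_domination (N : nat) (r M : R) (b : nat -> C) : Prop :=
  forall k : nat, (N + 1 <= k)%nat ->
    Cmod (b k) * r ^ k <= M * MaxRlist (map (fun i => Cmod (b i) * r ^ i) (seq 0 (N + 1))).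

(* Main.v *)
Require Import Defs.
From Stdlib Require Import Reals RList List Lra Lia.
From Coquelicot Require Import Coquelicot.
Open Scope R_scope.

(** Both conditions say that each term is controlled, uniformly in its
    position, by the [d] terms just before it.

    From a recurrence to domination: if the coefficients are bounded by [L],
    multiplying the [k]-th term by [r ^ k] replaces [c_j(k)] by
    [c_j(k) * r ^ j], of modulus at most [L * r] when [r <= 1].  Once
    [d * L * r <= 1] the [d] rescaled coefficients have total mass at most one,
    so no rescaled term can exceed the largest of the first [d]
    ([rescaled_solution_le]).  This works from every starting point [m] with the
    same [r], and with constant 1.

    From domination to a recurrence: applied at [m = k - d] and to the single
    index [d], domination reads [|a_k| <= Q * |v|], where [v] is the vector
    (a_{k-1}, ..., a_{k-d}) and [Q] does not depend on [k]
    ([taylor_domination_le_window_norm]).  The linear form of least norm sending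
    [v] to [a_k] is w |-> (a_k / |v|^2) * <w, v>; its norm is [|a_k| / |v|], so its
    coefficients are bounded by [Q].  If [v = 0] then [a_k = 0] as well, and
    the zero form will do. *)

Lemma le_MaxRlist_map_seq (f : nat -> R) (n i : nat) :
  (i < n)%nat -> f i <= MaxRlist (map f (seq 0 n)).
Proof.
  intros Hi. apply MaxRlist_P1, in_map, in_seq. lia.
Qed.

Lemma MaxRlist_map_seq_le (f : nat -> R) (n : nat) (B : R) :
  (0 < n)%nat -> (forall i, (i < n)%nat -> f i <= B) ->
  MaxRlist (map f (seq 0 n)) <= B.
Proof.
  intros Hn Hf.
  assert (Hin : In (MaxRlist (map f (seq 0 n))) (map f (seq 0 n))).
  { apply MaxRlist_P2. exists (f 0%nat). apply in_map, in_seq. lia. }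
  apply in_map_iff in Hin. destruct Hin as [i [<- Hi]].
  apply in_seq in Hi. apply Hf. lia.
Qed.

(** * Recurrences give domination *)

Lemma Cmod_sum_le (f : nat -> C) (B : R) (n : nat) :
  (forall j, (1 <= j <= n)%nat -> Cmod (f j) <= B) ->
  Cmod (sum_n_m f 1 n) <= INR n * B.
Proof.
  induction n as [|n IH]; intros Hf.
  - rewrite sum_n_m_zero by lia. change (Cmod (RtoC 0) <= INR 0 * B).
    rewrite Cmod_0. simpl. lra.
  - rewrite sum_n_Sm by lia. rewrite S_INR.
    eapply Rle_trans; [apply Cmod_triangle|].
    assert (H1 := Hf (S n) ltac:(lia)).
    assert (H2 := IH (fun j Hj => Hf j ltac:(lia))).
    lra.
Qed.

(** The maximum principle for the rescaled terms: each is a combination of the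
    [d] preceding ones with coefficients of total mass at most one. *)
Lemma rescaled_solution_le (d : nat) (c : nat -> nat -> C) (a : nat -> C)
    (L r B : R) (m : nat) :
  (1 <= d)%nat -> solves_recurrence d c a ->
  (forall k j, (d <= k)%nat -> (1 <= j <= d)%nat -> Cmod (c j k) <= L) ->
  0 < r <= 1 -> INR d * (L * r) <= 1 ->
  (forall i, (i < d)%nat -> Cmod (a (m + i)%nat) * r ^ i <= B) ->
  forall k, Cmod (a (m + k)%nat) * r ^ k <= B.
Proof.
  intros Hd Hrec HL [Hr0 Hr1] Hmass Hinit k.
  assert (HB : 0 <= B).
  { eapply Rle_trans; [|apply (Hinit 0%nat); lia].
    apply Rmult_le_pos; [apply Cmod_ge_0|apply pow_le; lra]. }
  assert (HL0 : 0 <= L).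
  { eapply Rle_trans; [apply Cmod_ge_0|apply (HL d d); lia]. }
  induction k as [k IH] using (well_founded_induction Nat.lt_wf_0).
  destruct (Nat.lt_ge_cases k d) as [Hk|Hk]; [now apply Hinit|].
  assert (Hpk : 0 < r ^ k) by now apply pow_lt.
  apply Rle_div_r; [exact Hpk|].
  rewrite Hrec by lia.
  eapply Rle_trans; [apply (Cmod_sum_le _ (L * r * (B / r ^ k)))|].
  - intros j Hj. rewrite Cmod_mult.
    replace (L * r * (B / r ^ k)) with (L * (r * (B / r ^ k))) by ring.
    apply Rmult_le_compat; try apply Cmod_ge_0; [apply HL; lia|].
    replace (m + k - j)%nat with (m + (k - j))%nat by lia.
    assert (Hb := IH (k - j)%nat ltac:(lia)).
    assert (Hpj : 0 < r ^ (k - j)) by now apply pow_lt.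
    apply Rle_div_r in Hb; [|exact Hpj].
    eapply Rle_trans; [exact Hb|].
    (* The factor r ^ j gained from the shift is at most r because 1 <= j. *)
    replace (B / r ^ (k - j)) with (r ^ j * (B / r ^ k)).
    2:{ replace (r ^ k) with (r ^ j * r ^ (k - j))
          by (rewrite <- pow_add; f_equal; lia).
        field. split; apply pow_nonzero; lra. }
    apply Rmult_le_compat_r.
    + apply Rdiv_le_0_compat; assumption.
    + destruct j as [|j]; [lia|]. simpl.
      assert (r ^ j <= 1) by (rewrite <- (pow1 j); apply pow_incr; lra).
      assert (0 <= r ^ j) by (apply pow_le; lra). nra.
  - rewrite <- Rmult_assoc. rewrite <- (Rmult_1_l (B / r ^ k)) at 2.
    apply Rmult_le_compat_r; [|exact Hmass].
    apply Rdiv_le_0_compat; assumption.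
Qed.

(** * Domination gives a recurrence *)

(** The squared Euclidean norm of the window (a_{k-1}, ..., a_{k-d}). *)
Definition window_sqnorm (d : nat) (a : nat -> C) (k : nat) : R :=
  sum_n_m (fun j => Cmod (a (k - j)%nat) ^ 2) 1 d.

(** The coefficients of the linear form of least norm that takes the value
    [a k] on the window; they vanish when [a k] does. *)
Definition least_norm_coefficient (d : nat) (a : nat -> C) (j k : nat) : C :=
  Cmult (Cmult (a k) (RtoC (/ window_sqnorm d a k))) (Cconj (a (k - j)%nat)).

Lemma sum_sqr_nonneg (g : nat -> R) (n : nat) :
  0 <= sum_n_m (fun j => g j ^ 2) 1 n.
Proof.
  induction n as [|n IH].
  - rewrite sum_n_m_zero by lia. apply Rle_refl.
  - rewrite sum_n_Sm by lia. apply Rplus_le_le_0_compat; [exact IH|].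
    apply pow2_ge_0.
Qed.

Lemma sqr_le_sum_sqr (g : nat -> R) (n j : nat) :
  (1 <= j <= n)%nat -> g j ^ 2 <= sum_n_m (fun i => g i ^ 2) 1 n.
Proof.
  induction n as [|n IH]; intros Hj; [lia|].
  rewrite sum_n_Sm by lia.
  change (g j ^ 2 <= sum_n_m (fun i => g i ^ 2) 1 n + g (S n) ^ 2).
  destruct (Nat.eq_dec j (S n)) as [->|Hne].
  - assert (H := sum_sqr_nonneg g n). lra.
  - assert (H := IH ltac:(lia)). assert (0 <= g (S n) ^ 2) by apply pow2_ge_0.
    lra.
Qed.

Lemma Cmod_le_window_norm (d : nat) (a : nat -> C) (k j : nat) :
  (1 <= j <= d)%nat -> Cmod (a (k - j)%nat) <= sqrt (window_sqnorm d a k).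
Proof.
  intros Hj. rewrite <- (sqrt_pow2 (Cmod (a (k - j)%nat))) by apply Cmod_ge_0.
  apply sqrt_le_1_alt.
  exact (sqr_le_sum_sqr (fun i => Cmod (a (k - i)%nat)) d j Hj).
Qed.

Lemma sum_RtoC (g : nat -> R) (n : nat) :
  sum_n_m (fun j => RtoC (g j)) 1 n = RtoC (sum_n_m g 1 n).
Proof.
  induction n as [|n IH].
  - rewrite !sum_n_m_zero by lia. reflexivity.
  - rewrite !sum_n_Sm by lia. rewrite IH. symmetry. apply RtoC_plus.
Qed.

(** Pairing the window with itself gives its squared norm, which cancels the
    denominator; on a zero window the bound forces [a k = 0]. *)
Lemma least_norm_coefficient_solves (d : nat) (a : nat -> C) (k : nat) (Q : R) :
  Cmod (a k) <= Q * sqrt (window_sqnorm d a k) ->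
  a k = sum_n_m
    (fun j => Cmult (least_norm_coefficient d a j k) (a (k - j)%nat)) 1 d.
Proof.
  intros HQ. set (S := window_sqnorm d a k) in *.
  transitivity (Cmult (Cmult (a k) (RtoC (/ S))) (RtoC S)).
  - destruct (Req_dec S 0) as [HS|HS].
    + rewrite HS, sqrt_0, Rmult_0_r in HQ.
      assert (H0 : a k = RtoC 0).
      { apply Cmod_eq_0. apply Rle_antisym; [exact HQ|apply Cmod_ge_0]. }
      rewrite H0. ring.
    + rewrite <- Cmult_assoc, <- RtoC_mult, Rinv_l by exact HS. ring.
  - unfold S at 2, window_sqnorm. rewrite <- sum_RtoC.
    rewrite <- (sum_n_m_mult_l (K := C_Ring)).
    apply sum_n_m_ext. intros j.
    unfold least_norm_coefficient. fold S.
    change mult with Cmult. rewrite Cmod2_conj.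
    match goal with |- ?x = ?y => change (@eq C x y) end. ring.
Qed.

Lemma Cmod_least_norm_coefficient_le (d : nat) (a : nat -> C) (k j : nat) (Q : R) :
  0 <= Q -> (1 <= j <= d)%nat ->
  Cmod (a k) <= Q * sqrt (window_sqnorm d a k) ->
  Cmod (least_norm_coefficient d a j k) <= Q.
Proof.
  intros HQ0 Hj HQ. unfold least_norm_coefficient.
  assert (Hw := Cmod_le_window_norm d a k j Hj).
  assert (HS0 : 0 <= window_sqnorm d a k)
    by exact (sum_sqr_nonneg (fun i => Cmod (a (k - i)%nat)) d).
  set (S := window_sqnorm d a k) in *.
  rewrite !Cmod_mult, Cmod_conj, Cmod_R.
  destruct (Req_dec S 0) as [HS|HS].
  - rewrite HS, sqrt_0, Rmult_0_r in HQ.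
    assert (H0 : Cmod (a k) = 0).
    { apply Rle_antisym; [exact HQ|apply Cmod_ge_0]. }
    rewrite H0, !Rmult_0_l. exact HQ0.
  - assert (HSi : 0 < / S) by (apply Rinv_0_lt_compat; lra).
    rewrite Rabs_pos_eq by lra.
    replace (Cmod (a k) * / S * Cmod (a (k - j)%nat))
      with (Cmod (a k) * Cmod (a (k - j)%nat) / S) by (unfold Rdiv; ring).
    apply Rle_div_l; [lra|].
    replace (Q * S) with (Q * sqrt S * sqrt S)
      by (rewrite Rmult_assoc, sqrt_sqrt by exact HS0; ring).
    apply Rmult_le_compat; auto using Cmod_ge_0.
Qed.

(** This is domination of the first term after the window; the weights
    [r ^ i], [i < d], in the maximum are all absorbed by [(1 + r) ^ d]. *)
Lemma taylor_domination_le_window_norm (d : nat) (a : nat -> C) (r M : R) (k : nat) :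
  (1 <= d <= k)%nat -> 0 < r -> 0 < M ->
  taylor_domination (d - 1) r M (fun i => a (k - d + i)%nat) ->
  Cmod (a k) <= M * (1 + r) ^ d / r ^ d * sqrt (window_sqnorm d a k).
Proof.
  intros Hk Hr HM HT. specialize (HT d ltac:(lia)). cbv beta in HT.
  replace (k - d + d)%nat with k in HT by lia.
  replace (d - 1 + 1)%nat with d in HT by lia.
  assert (Hp : 0 < r ^ d) by now apply pow_lt.
  replace (M * (1 + r) ^ d / r ^ d * sqrt (window_sqnorm d a k))
    with (M * (sqrt (window_sqnorm d a k) * (1 + r) ^ d) / r ^ d)
    by (unfold Rdiv; ring).
  apply Rle_div_r; [exact Hp|].
  eapply Rle_trans; [exact HT|].
  apply Rmult_le_compat_l; [lra|].
  apply MaxRlist_map_seq_le; [lia|]. intros i Hi.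
  apply Rmult_le_compat; [apply Cmod_ge_0|apply pow_le; lra| |].
  - replace (k - d + i)%nat with (k - (d - i))%nat by lia.
    apply Cmod_le_window_norm. lia.
  - eapply Rle_trans; [apply (pow_incr r (1 + r)); lra|].
    apply Rle_pow; [lra|lia].
Qed.

(** * The equivalence *)

Theorem theorem3p3 :
  forall (d : nat) (a : nat -> C),
    (1 <= d)%nat ->
    ((exists c : nat -> nat -> C,
        bounded_coefficients d c /\ solves_recurrence d c a)
     <->
     (exists r M : R,
        0 < r /\ 0 < M /\
        forall m : nat, taylor_domination (d - 1) r M (fun k => a (m + k)%nat))).
Proof.
  intros d a Hd. split.
  - intros [c [[L HL] Hrec]].
    assert (HL0 : 0 <= L).
    { eapply Rle_trans; [apply Cmod_ge_0|apply (HL d d); lia]. }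
    assert (HD : 0 <= INR d * L) by (apply Rmult_le_pos; [apply pos_INR|lra]).
    (* The added 1 keeps r <= 1 and covers L = 0. *)
    exists (/ (INR d * L + 1)), 1.
    set (r := / (INR d * L + 1)).
    assert (Hr : r * (INR d * L + 1) = 1) by (apply Rinv_l; lra).
    assert (Hr0 : 0 < r) by (apply Rinv_0_lt_compat; lra).
    split; [exact Hr0|]. split; [lra|].
    intros m k _. rewrite Rmult_1_l.
    apply (rescaled_solution_le d c a L); try assumption; try nra.
    intros i Hi.
    apply (le_MaxRlist_map_seq (fun i => Cmod (a (m + i)%nat) * r ^ i)). lia.
  - intros [r [M [Hr [HM HT]]]].
    set (Q := M * (1 + r) ^ d / r ^ d).
    assert (HQ0 : 0 <= Q).
    { apply Rdiv_le_0_compat; [|now apply pow_lt].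
      apply Rmult_le_pos; [lra|apply pow_le; lra]. }
    assert (HQ : forall k, (d <= k)%nat ->
                 Cmod (a k) <= Q * sqrt (window_sqnorm d a k)).
    { intros k Hk. apply taylor_domination_le_window_norm; auto. }
    exists (least_norm_coefficient d a). split.
    + exists Q. intros k j Hk Hj.
      apply Cmod_least_norm_coefficient_le; auto.
    + intros k Hk. apply (least_norm_coefficient_solves d a k Q). auto.
Qed.
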